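(* Suppose that $Q_0(z,u)$, $Q_1(z,u)$ and $Q_2(z,u)$ are polynomials in $z$ and $u$ with non-negative coefficients, and let $M(z,u)$ be the power series solution of $$M(z,u) = Q_0(z,u) + z\, M(z,u)\, Q_1(z,u) + z\,\frac{M(z,u)-M(z,0)}{u}\, Q_2(z,u).$$ Furthermore let $u(z)$ be the power series solution of the equation $$u(z) = zQ_2(z,u(z)) + z\,u(z)\,Q_1(z,u(z)), \qquad u(0)=0.$$ Then $M(z,0)$ is given by $$M(z,0) = \frac{Q_0(z,u(z))}{1-zQ_1(z,u(z))}.$$
   Context: The variable $u$ is called a catalytic variable. The displayed functional equation has a unique power series solution $M(z,u)$ (a formal power series in $z$ whose coefficients are polynomials in $u$), and the equation for $u(z)$ has a unique power series solution with $u(0)=0$. *)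

(* Defs.v *)
From HB Require Import structures.
From mathcomp Require Import all_boot all_order all_algebra.
From mathcomp Require Import boolp.

Set Implicit Arguments.
Unset Strict Implicit.
Unset Printing Implicit Defensive.

Import GRing.Theory.
Local Open Scope ring_scope.

(* {fps A} is the ring A[[z]]; the series s has coefficients s 0, s 1, ...    *)
Record fps (A : Type) := FPS { fps_coef :> nat -> A }.

Notation "{ 'fps' A }" := (fps A) (at level 0, format "{ 'fps'  A }").

HB.instance Definition _ (A : Type) := gen_eqMixin {fps A}.
HB.instance Definition _ (A : Type) := gen_choiceMixin {fps A}.

Lemma fpsP (A : Type) (s t : {fps A}) : s =1 t <-> s = t.
Proof.
split=> [|-> //]; case: s t => [f] [g] /= fg.
by congr FPS; apply: funext.
Qed.

Section FpsZmod.
Variable A : zmodType.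
Implicit Types s t : {fps A}.

Definition fps_zero : {fps A} := FPS (fun=> 0).
Definition fps_opp s : {fps A} := FPS (fun n => - s n).
Definition fps_add s t : {fps A} := FPS (fun n => s n + t n).

Fact fps_addA : associative fps_add.
Proof. by move=> r s t; apply/fpsP => n /=; rewrite addrA. Qed.

Fact fps_addC : commutative fps_add.
Proof. by move=> s t; apply/fpsP => n /=; rewrite addrC. Qed.

Fact fps_add0 : left_id fps_zero fps_add.
Proof. by move=> s; apply/fpsP => n /=; rewrite add0r. Qed.

Fact fps_addN : left_inverse fps_zero fps_opp fps_add.
Proof. by move=> s; apply/fpsP => n /=; rewrite addNr. Qed.

HB.instance Definition _ :=
  GRing.isZmodule.Build {fps A} fps_addA fps_addC fps_add0 fps_addN.

End FpsZmod.

Section FpsRing.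
Variable A : comNzRingType.
Implicit Types s t : {fps A}.

Definition fps_one : {fps A} := FPS (fun n => (n == 0%N)%:R).
Definition fps_mul s t : {fps A} :=
  FPS (fun n => \sum_(i < n.+1) s i * t (n - i)%N).

Definition fps_trunc m s : {poly A} := \poly_(i < m) s i.

Fact coef_fps_mul m s t n : (n < m)%N ->
  fps_mul s t n = (fps_trunc m s * fps_trunc m t)`_n.
Proof.
move=> lt_nm; rewrite coefM; apply: eq_bigr => i _; rewrite !coef_poly.
have lt_im : (i < m)%N by apply: leq_trans lt_nm; apply: ltn_ord.
by rewrite lt_im (leq_ltn_trans (leq_subr i n) lt_nm).
Qed.

Fact fps_mulC : commutative fps_mul.
Proof.
by move=> s t; apply/fpsP => n; rewrite !(@coef_fps_mul n.+1) // mulrC.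
Qed.

Fact fps_mulA : associative fps_mul.
Proof.
move=> r s t; apply/fpsP => n.
transitivity ((fps_trunc n.+1 r * (fps_trunc n.+1 s * fps_trunc n.+1 t))`_n).
  rewrite coefM; apply: eq_bigr => i _.
  by rewrite -coef_fps_mul ?ltnS ?leq_subr // coef_poly ltn_ord.
rewrite mulrA coefM; apply: eq_bigr => i _.
by rewrite -coef_fps_mul // coef_poly ltnS leq_subr.
Qed.

Fact fps_mul1 : left_id fps_one fps_mul.
Proof.
move=> s; apply/fpsP => n /=; rewrite big_ord_recl subn0 mul1r big1 ?addr0 //.
by move=> i _; rewrite mul0r.
Qed.

Fact fps_mulDl : left_distributive fps_mul (@fps_add A).
Proof.
move=> r s t; apply/fpsP => n /=; rewrite -big_split.
by apply: eq_bigr => i _; rewrite mulrDl.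
Qed.

Fact fps_one_neq0 : fps_one != 0.
Proof.
by apply/eqP => /fpsP/(_ 0%N) /= /eqP; rewrite oner_eq0.
Qed.

HB.instance Definition _ := GRing.Zmodule_isComNzRing.Build {fps A}
  fps_mulA fps_mulC fps_mul1 fps_mulDl fps_one_neq0.

End FpsRing.

Section FpsUnitRing.
Variable A : comUnitRingType.
Implicit Types s t : {fps A}.

Definition fps_unit : {pred {fps A}} := fun s => s 0%N \is a GRing.unit.

(* The coefficients b_(n-1), ..., b_0 of the inverse b of s, obtained from    *)
(* b_0 = s_0^-1 and s_0 b_k = - (s_1 b_(k-1) + ... + s_k b_0).                *)
Fixpoint fps_inv_rec s n : seq A :=
  if n is k.+1 then
    let b := fps_inv_rec s k in
    (s 0%N)^-1 * ((k == 0%N)%:R - \sum_(i < k) s i.+1 * b`_i) :: b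
  else [::].

(* As for the other unit rings of the library, non-units are left unchanged.  *)
Definition fps_inv s : {fps A} :=
  if s \in fps_unit then FPS (fun n => (fps_inv_rec s n.+1)`_0) else s.

Fact nth_fps_inv_rec s n i : (i < n)%N ->
  (fps_inv_rec s n)`_i = (fps_inv_rec s (n - i))`_0.
Proof. by elim: n i => // n IHn [|i] //= /IHn ->. Qed.

Fact fps_mulVx : {in fps_unit, left_inverse 1 fps_inv *%R}.
Proof.
move=> s Us; rewrite mulrC; apply/fpsP => n.
rewrite /fps_inv Us; set b := FPS _.
change (\sum_(i < n.+1) s i * b (n - i)%N = (n == 0%N)%:R).
rewrite big_ord_recl subn0 {1}/b /= mulrA divrr // mul1r.
rewrite [X in _ - X](eq_bigr (fun i : 'I_n => s i.+1 * b (n - i.+1)%N)) ?subrK //.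
by move=> i _; rewrite nth_fps_inv_rec // -[(n - i)%N]prednK ?subn_gt0 // -subnS.
Qed.

Fact fps_unitPl s t : t * s = 1 -> fps_unit s.
Proof.
move=> /fpsP/(_ 0%N); rewrite [LHS]big_ord_recl big_ord0 addr0 => ts1.
by apply/unitrPr; exists (t 0%N); rewrite mulrC.
Qed.

Fact fps_inv_out : {in [predC fps_unit], fps_inv =1 id}.
Proof. by move=> s; rewrite inE /fps_inv => /negbTE ->. Qed.

HB.instance Definition _ := GRing.ComNzRing_hasMulInverse.Build {fps A}
  fps_mulVx fps_unitPl fps_inv_out.

End FpsUnitRing.

Section FpsConstructions.

Definition fps_map (A B : Type) (f : A -> B) (s : {fps A}) : {fps B} :=
  FPS (fun n => f (s n)).

Definition fpsC (A : nzRingType) (c : A) : {fps A} :=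
  FPS (fun n => if n == 0%N then c else 0).

Definition fpsX (A : nzRingType) : {fps A} := FPS (fun n => (n == 1%N)%:R).

Definition fps_of_poly (A : nzRingType) (p : {poly A}) : {fps A} :=
  FPS (fun n => p`_n).

(* Hence the reciprocal 1 / (1 - z s) is a genuine one. *)
Lemma fps_unit_1subX (A : comUnitRingType) (s : {fps A}) :
  1 - fpsX A * s \is a GRing.unit.
Proof.
rewrite unfold_in /=; change ((1 : A) + - (\sum_(i < 1) fpsX A i * s (0 - i)%N)
  \is a GRing.unit).
by rewrite big_ord1 mul0r subr0 unitr1.
Qed.

End FpsConstructions.

Notation "''z'" := (fpsX _) (at level 0) : ring_scope.

(* A polynomial Q(z,u) is an element of {poly {poly R}} with outer variable z *)
(* and inner variable u, so that Q`_i`_j is the coefficient of z^i u^j.       *)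
(* Likewise {fps {poly R}} is R[u][[z]].                                      *)

Section Catalytic.
Variable R : fieldType.

(* Q(z, s(z)), by evaluating Q in the R-algebra {fps R} at the point (z, s)   *)
Definition subst_u (Q : {poly {poly R}}) (s : {fps R}) : {fps R} :=
  (map_poly (map_poly (@fpsC R)) Q).['z, s].

Definition at_u0 (M : {fps {poly R}}) : {fps R} :=
  fps_map (fun p => p.[0]) M.

(* (M(z,u) - M(z,0)) / u; the division by u is exact, coefficient by          *)
(* coefficient in z.                                                          *)
Definition divided_diff (M : {fps {poly R}}) : {fps {poly R}} :=
  fps_map (fun p => p %/ 'X) (M - fps_map polyC (at_u0 M)).

End Catalytic.

(* Main.v *)
(** Substituting u = u(z) into the functional equation is legitimate because
    M lies in R[u][[z]]: the coefficient of z^n in M(z,u(z)) involves only the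
    first n+1 coefficients of M, so that M(z,u) |-> M(z,u(z)) is a ring morphism.
    Write D(z,u) for the divided difference of M, m for M(z,0) and d for D(z,u(z)).
    Since M = M(z,0) + u D, the equation for M becomes
      m + u d = Q0 + z (m + u d) Q1 + z d Q2    at u = u(z),
    where the equation defining u(z) says precisely that the terms in d cancel,
    leaving m = Q0 + z m Q1. Cancelling them in this form, rather than
    multiplying by u first, avoids a separate treatment of u(z) = 0. *)

Require Import Defs.
From HB Require Import structures.
From mathcomp Require Import all_boot all_order all_algebra.
From mathcomp Require Import ring.

Set Implicit Arguments.
Unset Strict Implicit.
Unset Printing Implicit Defensive.

Import Order.TTheory GRing.Theory Num.Theory.
Local Open Scope ring_scope.

Section FpsRingTheory.
Variable A : comNzRingType.
Implicit Types s t : {fps A}.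

Lemma coef_fpsD s t n : (s + t) n = s n + t n.
Proof. by []. Qed.

Lemma coef_fpsM s t n : (s * t) n = \sum_(i < n.+1) s i * t (n - i)%N.
Proof. by []. Qed.

Lemma coef_fpsXM s n : ('z * s) n = if n is m.+1 then s m else 0.
Proof.
rewrite coef_fpsM big_ord_recl mul0r add0r.
case: n => [|n]; first by rewrite big_ord0.
rewrite big_ord_recl mul1r subn1 big1 ?addr0 // => i _.
by rewrite mul0r.
Qed.

Lemma coef_fpsCM c s n : (fpsC c * s) n = c * s n.
Proof.
rewrite coef_fpsM big_ord_recl subn0 big1 ?addr0 // => i _.
by rewrite mul0r.
Qed.

Lemma coef_fpsXnM_lt s m n : (n < m)%N -> ('z ^+ m * s) n = 0.
Proof.
elim: m n => // m IHm [|n] lt_nm; rewrite exprS -mulrA coef_fpsXM //.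
exact: IHm.
Qed.

Fact fpsC_is_zmod_morphism : zmod_morphism (@fpsC A).
Proof. by move=> a b; apply/fpsP => -[|n] //=; rewrite subr0. Qed.

Fact fpsC_is_monoid_morphism : monoid_morphism (@fpsC A).
Proof.
split=> [|a b]; first by apply/fpsP => -[|n].
by apply/fpsP => -[|n]; rewrite coef_fpsCM //= mulr0.
Qed.

HB.instance Definition _ :=
  GRing.isZmodMorphism.Build A {fps A} (@fpsC A) fpsC_is_zmod_morphism.
HB.instance Definition _ :=
  GRing.isMonoidMorphism.Build A {fps A} (@fpsC A) fpsC_is_monoid_morphism.

Lemma coef_fps_trunc m s i : (fps_trunc m s)`_i = if (i < m)%N then s i else 0.
Proof. exact: coef_poly. Qed.

End FpsRingTheory.

Section Substitution.
Variable R : fieldType.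
Implicit Types (s : {fps R}) (P Q : {poly {poly R}}) (M N : {fps {poly R}}).

Lemma subst_uD P Q s : subst_u (P + Q) s = subst_u P s + subst_u Q s.
Proof. by rewrite /subst_u rmorphD !hornerD. Qed.

Lemma subst_uM P Q s : subst_u (P * Q) s = subst_u P s * subst_u Q s.
Proof. by rewrite /subst_u rmorphM !hornerM. Qed.

Lemma subst_uC (p : {poly R}) s : subst_u p%:P s = (map_poly (@fpsC R) p).[s].
Proof. by rewrite /subst_u map_polyC hornerC. Qed.

Lemma subst_uX s : subst_u 'X s = 'z.
Proof. by rewrite /subst_u map_polyX hornerX hornerC. Qed.

Lemma subst_uXn m s : subst_u 'X^m s = 'z ^+ m.
Proof. by rewrite /subst_u map_polyXn hornerXn -polyC_exp hornerC. Qed.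

(** The discarded part of [Q] is a multiple of ['X^n.+1], which becomes a multiple of ['z ^+ n.+1],
    whatever the constant term of [s]. *)
Lemma coef_subst_u_take n Q s :
  subst_u (take_poly n.+1 Q) s n = subst_u Q s n.
Proof.
rewrite -[in RHS](poly_take_drop n.+1 Q) subst_uD subst_uM subst_uXn mulrC.
by rewrite coef_fpsD coef_fpsXnM_lt ?addr0.
Qed.

Lemma eq_coef_subst_u n P Q s :
  (forall i, (i <= n)%N -> P`_i = Q`_i) -> subst_u P s n = subst_u Q s n.
Proof.
move=> eqPQ; rewrite -(coef_subst_u_take n P) -(coef_subst_u_take n Q).
congr (subst_u _ s n); apply/polyP => i; rewrite !coef_take_poly.
by case: ltnP => // /eqPQ.
Qed.

(** A series in ['z] cannot be evaluated by [horner], so each coefficient is read off a truncation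
    of [M], which is a polynomial. *)
Definition fps_subst_u M s : {fps R} :=
  FPS (fun n => subst_u (fps_trunc n.+1 M) s n).

(** Frees the definition from its particular truncation, so that each proof can choose a convenient
    polynomial [Q]. *)
Lemma coef_fps_subst_u M s Q n :
  (forall i, (i <= n)%N -> Q`_i = M i) -> fps_subst_u M s n = subst_u Q s n.
Proof.
move=> eqQM; apply: eq_coef_subst_u => i le_in.
by rewrite coef_fps_trunc ltnS le_in eqQM.
Qed.

Lemma fps_subst_uD M N s :
  fps_subst_u (M + N) s = fps_subst_u M s + fps_subst_u N s.
Proof.
apply/fpsP => n; rewrite coef_fpsD /= -coef_fpsD -subst_uD.
apply: coef_fps_subst_u => i le_in.
by rewrite coefD !coef_fps_trunc ltnS le_in.
Qed.

Lemma fps_subst_uM M N s :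
  fps_subst_u (M * N) s = fps_subst_u M s * fps_subst_u N s.
Proof.
apply/fpsP => n.
(* The product of the truncations may have terms beyond ['X^n], but it agrees with [M * N] up to
   there, and [subst_u] is multiplicative on it. *)
rewrite (@coef_fps_subst_u _ _ (fps_trunc n.+1 M * fps_trunc n.+1 N)); last first.
  by move=> i le_in; rewrite -coef_fps_mul.
rewrite subst_uM !coef_fpsM; apply: eq_bigr => i _.
have trunc_coef L j : (j <= n)%N ->
    subst_u (fps_trunc n.+1 L) s j = fps_subst_u L s j.
  move=> le_jn; apply/esym/coef_fps_subst_u => k le_kj.
  by rewrite coef_fps_trunc ltnS (leq_trans le_kj le_jn).
by rewrite !trunc_coef ?leq_subr // -ltnS.
Qed.

Lemma fps_subst_u_poly Q s : fps_subst_u (fps_of_poly Q) s = subst_u Q s.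
Proof. by apply/fpsP => n; apply: coef_fps_subst_u. Qed.

Lemma fps_subst_uX s : fps_subst_u 'z s = 'z.
Proof.
rewrite -[RHS](subst_uX s) -fps_subst_u_poly; congr fps_subst_u.
by apply/fpsP => n /=; rewrite coefX.
Qed.

Lemma fps_subst_uC (p : {poly R}) s :
  fps_subst_u (fpsC p) s = (map_poly (@fpsC R) p).[s].
Proof.
rewrite -subst_uC -fps_subst_u_poly; congr fps_subst_u.
by apply/fpsP => n /=; rewrite coefC.
Qed.

Lemma subst_u_map_polyC (q : {poly R}) s :
  subst_u (map_poly polyC q) s = fps_of_poly q.
Proof.
elim/poly_ind: q => [|q c IHq].
  by rewrite /subst_u !rmorph0 !horner0; apply/fpsP => n; rewrite /= coef0.
rewrite rmorphD rmorphM /= map_polyX map_polyC subst_uD subst_uM IHq subst_uX.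
rewrite subst_uC map_polyC hornerC mulrC; apply/fpsP => n.
rewrite coef_fpsD coef_fpsXM /= coefD coefMX coefC.
by case: n.
Qed.

Lemma fps_subst_u_map_polyC (t s : {fps R}) :
  fps_subst_u (fps_map polyC t) s = t.
Proof.
apply/fpsP => n.
rewrite (@coef_fps_subst_u _ _ (map_poly polyC (fps_trunc n.+1 t))).
  by rewrite subst_u_map_polyC /= coef_fps_trunc ltnSn.
by move=> i le_in; rewrite coef_map coef_fps_trunc ltnS le_in.
Qed.

Lemma divided_diffE M :
  M = fps_map polyC (at_u0 M) + fpsC 'X * divided_diff M.
Proof.
apply/fpsP => n; rewrite coef_fpsD coef_fpsCM /=.
have X_dvd (p : {poly R}) : 'X %| p - p.[0]%:P.
  (* Divisibility by ['X], seen as ['X - 0], means vanishing at 0. *)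
  by rewrite -['X]subr0 dvdp_XsubCl /root hornerD hornerN hornerC subrr.
by rewrite [X in _ + X]mulrC (divpK (X_dvd (M n))) addrC subrK.
Qed.

Lemma fps_subst_u_divided_diff M s :
  fps_subst_u M s = at_u0 M + s * fps_subst_u (divided_diff M) s.
Proof.
rewrite {1}(divided_diffE M) fps_subst_uD fps_subst_uM fps_subst_u_map_polyC.
by rewrite fps_subst_uC map_polyX hornerX.
Qed.

End Substitution.

Theorem proposition1 (R : realFieldType) (Q0 Q1 Q2 : {poly {poly R}})
    (Q0_ge0 : forall i j : nat, 0 <= Q0`_i`_j)
    (Q1_ge0 : forall i j : nat, 0 <= Q1`_i`_j)
    (Q2_ge0 : forall i j : nat, 0 <= Q2`_i`_j)
    (M : {fps {poly R}})
    (M_eq : M = fps_of_poly Q0 + 'z * M * fps_of_poly Q1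
                + 'z * divided_diff M * fps_of_poly Q2)
    (u : {fps R})
    (u_eq : u = 'z * subst_u Q2 u + 'z * u * subst_u Q1 u)
    (u_0 : u 0%N = 0) :
  at_u0 M = subst_u Q0 u / (1 - 'z * subst_u Q1 u).
Proof.
(* The denominator has constant term 1, so it is a unit and can be cleared. *)
apply: (mulIr (fps_unit_1subX (subst_u Q1 u))).
rewrite (divrK (fps_unit_1subX _)).
have := congr1 (fun N => fps_subst_u N u) M_eq.
rewrite !(fps_subst_uD, fps_subst_uM) !fps_subst_u_poly fps_subst_uX.
rewrite fps_subst_u_divided_diff.
move: u_eq; set q0 := subst_u Q0 u; set q1 := subst_u Q1 u.
set q2 := subst_u Q2 u; set d := fps_subst_u _ u; set m := at_u0 M.
move=> u_eq Mu_eq.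
have u_sub : u - 'z * u * q1 = 'z * q2 by rewrite {1}u_eq addrK.
(* Here [m + u * d] is M(z,u(z)). Only its first occurrence is then expanded by [Mu_eq]: the second
   cancels the [q1] term, and [u_sub] makes the last product cancel ['z * d * q2], leaving [q0]. *)
have -> : m * (1 - 'z * q1) = (m + u * d) - 'z * (m + u * d) * q1
    - d * (u - 'z * u * q1) by ring.
by rewrite {1}Mu_eq u_sub; ring.
Qed.
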